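(* Let $G$ and $H$ be graphs, where $H$ has no isolated vertices. Then $$\gamma_{gr}^{t}(G\boxtimes H)\ \ge\ \max\big\{(\gamma_{gr}(H)+1)\,c(D)+\gamma_{gr}(H)\,b(D)+(|\widehat{D}|-b(D)-c(D))\,\gamma_{gr}^{t}(H)\ :\ D\text{ is a dominating sequence of }G\big\}.$$
   Context: Graphs are finite, simple and undirected, with nonempty vertex set. $N(v)$ and $N[v]=N(v)\cup\{v\}$ denote open and closed neighborhoods. A legal open neighborhood sequence of a graph is a sequence $(v_1,\ldots,v_k)$ of distinct vertices with $N(v_i)\setminus\bigcup_{j=1}^{i-1}N(v_j)\neq\emptyset$ for each $i$; its maximum length is the Grundy total domination number $\gamma_{gr}^{t}$. A dominating sequence (legal closed neighborhood sequence) is a sequence $(d_1,\ldots,d_k)$ of distinct vertices with $N[d_i]\setminus\bigcup_{j=1}^{i-1}N[d_j]\neq\emptyset$ for each $i$; its maximum length is the Grundy domination number $\gamma_{gr}$. In a dominating sequence $D=(d_1,\ldots,d_k)$, the vertex $d_i$ footprints the vertices of $N[d_i]\setminus\bigcup_{j=1}^{i-1}N[d_j]$. $\widehat{D}=\{d_1,\ldots,d_k\}$. $c(D)$ is the number of vertices $d_i$ of $D$ that footprint themselves and at least one of their neighbors; $b(D)$ is the number of vertices $d_i$ of $D$ that do not footprint themselves and footprint at least one of their neighbors. The strong product $G\boxtimes H$ has vertex set $V(G)\times V(H)$, and $(g_1,h_1)$, $(g_2,h_2)$ are adjacent iff $g_1g_2\in E(G)$ and $h_1=h_2$, or $g_1=g_2$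 and $h_1h_2\in E(H)$, or $g_1g_2\in E(G)$ and $h_1h_2\in E(H)$. *)

(* Defs.v *)
From mathcomp Require Import all_boot.

Set Implicit Arguments.
Unset Strict Implicit.
Unset Printing Implicit Defensive.

Record sgraph := SGraph {
  vertex :> finType;
  adj : rel vertex;
  adj_sym : symmetric adj;
  adj_irrefl : irreflexive adj;
  vertex_gt0 : 0 < #|vertex| }.

Definition onbhd (G : sgraph) (v : G) : {set G} := [set u | adj v u].
Definition cnbhd (G : sgraph) (v : G) : {set G} := v |: onbhd v.

Definition no_isolated (G : sgraph) : Prop :=
  forall v : G, onbhd v != set0.

Section StrongProduct.
Variables G H : sgraph.

Definition strong_adj (x y : G * H) : bool :=
  [|| adj x.1 y.1 && (x.2 == y.2),
      (x.1 == y.1) && adj x.2 y.2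
    | adj x.1 y.1 && adj x.2 y.2].

Lemma strong_adj_sym : symmetric strong_adj.
Proof.
move=> x y; rewrite /strong_adj (adj_sym x.1) (adj_sym x.2).
by rewrite (eq_sym x.1) (eq_sym x.2).
Qed.

Lemma strong_adj_irrefl : irreflexive strong_adj.
Proof. by move=> x; rewrite /strong_adj !adj_irrefl andbF. Qed.

Lemma strong_vertex_gt0 : 0 < #|{: G * H}|.
Proof. by rewrite card_prod muln_gt0 !vertex_gt0. Qed.

Definition strong_product : sgraph :=
  SGraph strong_adj_sym strong_adj_irrefl strong_vertex_gt0.

End StrongProduct.

(* The vertices footprinted by a member x of the duplicate-free sequence s,
   where nb is the open or the closed neighborhood; take (index x s) s is the
   part of s strictly before x. *)
Definition footprint (T : finType) (nb : T -> {set T}) (s : seq T) (x : T) :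
  {set T} := nb x :\: \bigcup_(y <- take (index x s) s) nb y.

Definition legal (T : finType) (nb : T -> {set T}) (s : seq T) : bool :=
  uniq s && all (fun x => footprint nb s x != set0) s.

Definition legal_open (G : sgraph) (s : seq G) : bool := legal (@onbhd G) s.
Definition dominating_seq (G : sgraph) (s : seq G) : bool :=
  legal (@cnbhd G) s.

(* The maximum of F over the sequences satisfying P. Sequences longer than
   #|T| are left out, which is harmless when P implies uniq (see seqmax_ub);
   the empty sequence is always legal, so the maxima below are attained. *)
Definition seqmax (T : finType) (P : pred (seq T)) (F : seq T -> nat) : nat :=
  \max_(k < #|T|.+1) \max_(s : k.-tuple T | P s) F s.

Lemma seqmax_ub (T : finType) (P : pred (seq T)) (F : seq T -> nat) s :
  (forall t, P t -> uniq t) -> P s -> F s <= seqmax P F.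
Proof.
move=> Puniq Ps.
have ss : size s < #|T|.+1 by rewrite ltnS -(card_uniqP (Puniq _ Ps)) max_card.
rewrite /seqmax.
apply: leq_trans (leq_bigmax (Ordinal ss)).
exact: (@leq_bigmax_cond _ _ (fun t : _.-tuple T => F t) (in_tuple s)).
Qed.

Lemma seqmax_attained (T : finType) (P : pred (seq T)) (F : seq T -> nat) :
  P [::] -> exists2 s, P s & F s = seqmax P F.
Proof.
move=> P0.
suff [F0|] : seqmax P F = 0 \/ exists2 s, P s & F s = seqmax P F.
- exists [::] => //; apply/eqP; rewrite F0 -leqn0 -F0 /seqmax.
  apply: leq_trans (leq_bigmax (@ord0 #|T|)).
  exact: (@leq_bigmax_cond _ _ (fun t : _.-tuple T => F t) [tuple]).
- by [].
rewrite /seqmax; elim/big_ind: _ => [|m n mP nP|k _]; first by left.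
- by rewrite /maxn; case: ifP.
elim/big_ind: _ => [|m n mP nP|s Ps]; first by left.
- by rewrite /maxn; case: ifP.
by right; exists s.
Qed.

Definition grundy_total_domination (G : sgraph) : nat :=
  seqmax (@legal_open G) size.
Definition grundy_domination (G : sgraph) : nat :=
  seqmax (@dominating_seq G) size.

Section FootprintCounts.
Variables (G : sgraph) (D : seq G).

Definition footprints_self (d : G) : bool :=
  d \in footprint (@cnbhd G) D d.
Definition footprints_nbr (d : G) : bool :=
  [exists u, adj d u && (u \in footprint (@cnbhd G) D d)].

Definition count_c : nat :=
  #|[set d in D | footprints_self d && footprints_nbr d]|.
Definition count_b : nat :=
  #|[set d in D | ~~ footprints_self d && footprints_nbr d]|.

End FootprintCounts.

(* Main.v *)
Require Import Defs.
From mathcomp Require Import all_boot.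

(** Let [D] be a dominating sequence of [G].  Replace each [d] in [D] by a block
    of vertices [(d, h)], using that the open neighborhood of [(d, h)] is
    [N[d] x N[h]] minus [(d, h)].  If [d] footprints a neighbor [u], the row of
    [u] is untouched by the earlier blocks, and a longest dominating sequence of
    [H] yields a legal block.  If [d] also footprints itself, the row of [d] is
    untouched too, and one more vertex fits: replace the last vertex of the
    dominating sequence by a vertex [f] it footprints, followed by any neighbor
    [x] of [f]; then [(d, f)] footprints [(u, f)] and [(d, x)] footprints
    [(d, f)].  If [d] footprints only itself, a longest legal open neighborhood
    sequence of [H] yields a block that is legal in the row of [d]. *)

Section Legal.
Variables (T : finType) (nb : T -> {set T}).

Lemma bigcup_seqP (s : seq T) w :
  reflect (exists2 y, y \in s & w \in nb y) (w \in \bigcup_(y <- s) nb y).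
Proof.
rewrite bigcup_seq; apply: (iffP bigcupP) => -[y]; by exists y.
Qed.

Lemma footprint_split (s1 s2 : seq T) x : x \notin s1 ->
  footprint nb (s1 ++ x :: s2) x = nb x :\: \bigcup_(y <- s1) nb y.
Proof.
move=> xs; rewrite /footprint index_cat (negbTE xs) /= eqxx addn0.
by rewrite take_size_cat.
Qed.

Lemma footprint_rcons (s : seq T) x y : y \in s ->
  footprint nb (rcons s x) y = footprint nb s y.
Proof.
move=> ys; rewrite /footprint -cats1 index_cat ys take_cat.
by rewrite index_mem ys.
Qed.

(** Footprints depend only on earlier terms, so appending [x] leaves those of [s] unchanged and only
    [x] needs a witness. All blocks are built by this step. *)
Lemma legal_rconsP (s : seq T) x :
  reflect (legal nb s /\
           exists2 w, w \in nb x & forall y, y \in s -> w \notin nb y)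
          (legal nb (rcons s x)).
Proof.
rewrite /legal rcons_uniq all_rcons.
have -> : all (fun y => footprint nb (rcons s x) y != set0) s =
          all (fun y => footprint nb s y != set0) s.
  by apply: eq_in_all => y ys; rewrite footprint_rcons.
apply: (iffP idP) => [/andP[/andP[xs ->] /andP[fx ->]]|[/andP[-> ->] [w wx ws]]].
  split=> //; move: fx; rewrite -cats1 footprint_split // => /set0Pn[w].
  rewrite inE => /andP[wU wx]; exists w => // y ys.
  by apply: contra wU => wy; apply/bigcup_seqP; exists y.
have xs : x \notin s by apply/negP=> /ws; rewrite wx.
rewrite xs /= andbT -cats1 footprint_split //.
apply/set0Pn; exists w; rewrite inE wx andbT.
by apply/bigcup_seqP=> -[y /ws/negbTE->].
Qed.

Lemma legal_nil : legal nb [::]. Proof. by []. Qed.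

Lemma legal_uniq (s : seq T) : legal nb s -> uniq s.
Proof. by case/andP. Qed.

End Legal.

Section Blocks.
Variables G H : sgraph.
Implicit Types (P : seq (strong_product G H)) (d u : G) (S : seq H).

Lemma in_onbhd (K : sgraph) (v w : K) : (w \in onbhd v) = adj v w.
Proof. by rewrite inE. Qed.

Lemma in_cnbhd (K : sgraph) (v w : K) : (w \in cnbhd v) = (w == v) || adj v w.
Proof. by rewrite !inE. Qed.

Lemma in_onbhd_strong (d u : G) (h w : H) :
  ((u, w) \in @onbhd (strong_product G H) (d, h)) =
  [&& u \in cnbhd d, w \in cnbhd h & (u, w) != (d, h)].
Proof.
rewrite [LHS](@in_onbhd (strong_product G H)) !in_cnbhd /= /strong_adj /= xpair_eqE (eq_sym d) (eq_sym h).
case: (eqVneq u d) => [->|_]; case: (eqVneq w h) => [->|_];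
  by rewrite ?adj_irrefl /= ?andbF ?andbT ?orbF.
Qed.

(** If [x] footprints [w] in [S], then [(d, x)] footprints [(u, w)]: since [u] differs from [d], the
    pair [(d, x)] missing from the open neighborhood does no harm. *)
Lemma block_closed P d u S :
  legal_open P -> (forall p, p \in P -> u \notin cnbhd p.1) ->
  adj d u -> dominating_seq S ->
  legal_open (P ++ [seq (d, h) | h <- S]).
Proof.
move=> legP uP du; elim/last_ind: S => [|S x IH]; first by rewrite cats0.
case/legal_rconsP=> legS [w wx wS].
have ud : u != d by apply: contraTneq du => ->; rewrite adj_irrefl.
rewrite map_rcons -rcons_cat; apply/legal_rconsP; split; first exact: IH.
exists (u, w).
  by rewrite in_onbhd_strong wx in_cnbhd du orbT xpair_eqE (negbTE ud).
move=> [g h]; rewrite mem_cat in_onbhd_strong.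
case/orP=> [/uP/negbTE/= -> //|/mapP[h' /wS wh' [-> ->]]].
by rewrite (negbTE wh') andbF.
Qed.

(** Inside row [d], the open neighborhood of [(d, h)] is the copy of [onbhd h], so legality of [S]
    carries over. *)
Lemma block_open P d S :
  legal_open P -> (forall p, p \in P -> d \notin cnbhd p.1) ->
  legal_open S -> legal_open (P ++ [seq (d, h) | h <- S]).
Proof.
move=> legP dP; elim/last_ind: S => [|S x IH]; first by rewrite cats0.
case/legal_rconsP=> legS [w wx wS].
rewrite map_rcons -rcons_cat; apply/legal_rconsP; split; first exact: IH.
have rowE h : ((d, w) \in @onbhd (strong_product G H) (d, h)) = (w \in onbhd h).
  rewrite in_onbhd_strong !in_cnbhd in_onbhd xpair_eqE eqxx /=.
  by case: eqVneq => [->|]; rewrite ?adj_irrefl ?andbT.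
exists (d, w); first by rewrite rowE.
move=> [g h]; rewrite mem_cat => /orP[/dP /negbTE/= nd|/mapP[h' /wS wh' [-> ->]]].
  by rewrite in_onbhd_strong nd.
by rewrite rowE.
Qed.

Lemma block_closed_extra P d u S :
  no_isolated H -> legal_open P ->
  (forall p, p \in P -> u \notin cnbhd p.1) ->
  (forall p, p \in P -> d \notin cnbhd p.1) ->
  adj d u -> dominating_seq S -> 0 < size S ->
  exists S', legal_open (P ++ [seq (d, h) | h <- S']) /\ size S' = (size S).+1.
Proof.
move=> hH legP uP dP du; elim/last_ind: S => // S x _ /legal_rconsP[legS [f _ fS]] _.
have /set0Pn[y] := hH f; rewrite in_onbhd => fy.
exists (rcons (rcons S f) y); split; last by rewrite !size_rcons.
rewrite map_rcons -rcons_cat; apply/legal_rconsP; split.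
  (* [S] followed by [f] is still dominating, because [f] footprints itself. *)
  apply: (@block_closed P d u) => //; apply/legal_rconsP; split=> //.
  by exists f; rewrite // in_cnbhd eqxx.
exists (d, f).
  rewrite in_onbhd_strong !in_cnbhd eqxx adj_sym fy orbT xpair_eqE eqxx /=.
  by apply: contraTneq fy => ->; rewrite adj_irrefl.
move=> [g h]; rewrite in_onbhd_strong mem_cat.
case/orP=> [/dP/negbTE/= -> //|/mapP[h' + [-> ->]]].
(* The vertex [(d, f)] is not in its own open neighborhood, and members of [S] do not dominate
   [f]. *)
rewrite mem_rcons inE => /predU1P[->|/fS/negbTE->]; last by rewrite andbF.
by rewrite eqxx !andbF.
Qed.

End Blocks.

(** Ensures that a longest dominating sequence has a last vertex to replace. *)
Lemma grundy_domination_gt0 (K : sgraph) : 0 < grundy_domination K.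
Proof.
have /card_gt0P[v _] := vertex_gt0 K.
apply: (@leq_trans (size [:: v])) => //.
apply: seqmax_ub => [s|]; first exact: legal_uniq.
rewrite -[[:: v]]/(rcons [::] v); apply/legal_rconsP; split=> //.
by exists v; rewrite // in_cnbhd eqxx.
Qed.

Section Construction.
Variables (G H : sgraph) (D : seq G).
Hypotheses (hH : no_isolated H) (domD : dominating_seq D).

Definition block_size (d : G) : nat :=
  if footprints_nbr D d then grundy_domination H + footprints_self D d
  else grundy_total_domination H.

(** Induction on prefixes of a fixed [D], so that [block_size] keeps its meaning. As first
    coordinates of [P] stay in [D1], whatever the next [d] footprints is a row untouched by [P]. *)
Lemma block_sequence (D1 D2 : seq G) : D = D1 ++ D2 ->
  exists P : seq (strong_product G H),
    [/\ legal_open P, (forall p, p \in P -> p.1 \in D1)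
      & size P = \sum_(d <- D1) block_size d].
Proof.
elim/last_ind: D1 D2 => [|D1 d IH] D2 defD.
  by exists [::]; rewrite big_nil.
have {IH}[P [legP PD1 szP]] := IH (d :: D2) ltac:(by rewrite defD cat_rcons).
suff [S legPS szS] : exists2 S : seq H,
    legal_open (P ++ [seq (d, h) | h <- S] : seq (strong_product G H))
    & size S = block_size d.
  exists (P ++ [seq (d, h) | h <- S]); split=> //.
    move=> p; rewrite mem_cat mem_rcons inE.
    by case/orP=> [/PD1-> | /mapP[h _ ->]]; rewrite ?orbT ?eqxx.
  by rewrite size_cat size_map szP szS -cats1 big_cat big_seq1.
have dD1 : d \notin D1.
  have := legal_uniq _ _ _ domD; rewrite defD cat_uniq rcons_uniq.
  by case/andP=> /andP[].
have fE : footprint (@cnbhd G) D d = cnbhd d :\: \bigcup_(y <- D1) cnbhd y.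
  by rewrite defD cat_rcons footprint_split.
have newP v : v \in footprint (@cnbhd G) D d ->
    forall p, p \in P -> v \notin cnbhd p.1.
  rewrite fE inE => /andP[vU _] p /PD1 pD1.
  by apply: contra vU => vp; apply/bigcup_seqP; exists p.1.
have [S domS szS] := @seqmax_attained H (@dominating_seq H) size (@legal_nil _ _).
have [T legT szT] := @seqmax_attained H (@legal_open H) size (@legal_nil _ _).
rewrite /block_size; case: ifPn => [/existsP[u /andP[du uf]]|nonbr].
  case: (boolP (footprints_self D d)) => [df|_]; last first.
    exists S; rewrite ?addn0 //.
    by apply: (@block_closed G H P d u) => //; apply: newP.
  have S0 : 0 < size S by rewrite szS grundy_domination_gt0.
  have [S' [legS' szS']] := @block_closed_extra G H P d u S hH legP
    (newP u uf) (newP d df) du domS S0.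
  by exists S'; rewrite // szS' szS addn1.
exists T => //; apply: block_open => //; apply: newP.
(* By legality [d] footprints some [v]; as no neighbor is footprinted, [v] is [d] itself. *)
have dD : d \in D by rewrite defD mem_cat mem_rcons mem_head.
have /andP[_ /allP/(_ d dD)/set0Pn[v vf]] := domD.
move: (vf); rewrite {1}fE inE in_cnbhd => /andP[_ /predU1P[vd|dv]].
  by rewrite -[X in X \in _]vd.
by case/existsP: nonbr; exists v; rewrite dv.
Qed.

Lemma sum_block_size :
  \sum_(d <- D) block_size d =
    (grundy_domination H + 1) * count_c D + grundy_domination H * count_b D
    + (#|[set d in D]| - count_b D - count_c D) * grundy_total_domination H.
Proof.
have -> : count_c D =
    \sum_(d in [set d in D] | footprints_nbr D d) footprints_self D d.
  rewrite /count_c -sum1_card [LHS]big_mkcond [RHS]big_mkcond.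
  apply: eq_bigr => d _; rewrite !inE.
  by case: (d \in D); case: footprints_nbr; case: footprints_self.
have -> : count_b D =
    \sum_(d in [set d in D] | footprints_nbr D d) ~~ footprints_self D d.
  rewrite /count_b -sum1_card [LHS]big_mkcond [RHS]big_mkcond.
  apply: eq_bigr => d _; rewrite !inE.
  by case: (d \in D); case: footprints_nbr; case: footprints_self.
set a := grundy_domination H; set t := grundy_total_domination H.
rewrite -subnDA -big_split /=.
(* Each [d] footprinting a neighbor is counted exactly once in [count_c] or [count_b], so the
   truncated subtraction is exact and leaves the other members of [D]. *)
rewrite [X in _ - X](eq_bigr (fun=> 1)); last first.
  by move=> d _; case: footprints_self.
rewrite -sum1_card (bigID (footprints_nbr D) (mem [set d in D])) /= addKn.
rewrite (big_uniq _ (legal_uniq _ _ _ domD)) /=.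
rewrite -(eq_bigl _ _ (in_set (mem D))).
rewrite (bigID (footprints_nbr D)) /=; congr (_ + _).
  rewrite !big_distrr -big_split /=; apply: eq_bigr => d /andP[_ nd].
  by rewrite /block_size nd -/a; case: footprints_self; rewrite ?muln1 ?muln0 ?addn0.
rewrite big_distrl /=; apply: eq_bigr => d /andP[_ nd].
by rewrite /block_size (negbTE nd) mul1n.
Qed.

End Construction.

Theorem theorem4p2 (G H : sgraph) (hH : no_isolated H) :
  seqmax (@dominating_seq G)
    (fun D : seq G =>
       (grundy_domination H + 1) * count_c D
       + grundy_domination H * count_b D
       + (#|[set d in D]| - count_b D - count_c D)
         * grundy_total_domination H)
  <= grundy_total_domination (strong_product G H).
Proof.
have [D domD <-] := seqmax_attained
  (fun D => (grundy_domination H + 1) * count_c D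
    + grundy_domination H * count_b D
    + (#|[set d in D]| - count_b D - count_c D) * grundy_total_domination H)
  (legal_nil _ (@cnbhd G)).
rewrite -(sum_block_size G H D domD).
have [|P [legP _ <-]] := block_sequence G H D hH domD D [::]; first by rewrite cats0.
by apply: seqmax_ub => // s; apply: legal_uniq.
Qed.
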